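(* Let $n\geq 3$ and let $a\in\mathbb{R}^n$. Let $f:\mathbb{R}^n\to\mathbb{R}^n$ be such that $f$ is $C^1$ on $\mathbb{R}^n\setminus\{a\}$, with $\det Df\neq 0$ on $\mathbb{R}^n\setminus\{a\}$, and that $f$ is continuous at $a$. Let $b:=f(a)$, and assume that $f(\mathbb{R}^n\setminus\{a\})\subset\mathbb{R}^n\setminus\{b\}$ and that $|y|\to\infty$ implies $|f(y)|\to\infty$. Then the mapping $f:\mathbb{R}^n\to\mathbb{R}^n$ is a global homeomorphism and its restriction $f:\mathbb{R}^n\setminus\{a\}\to\mathbb{R}^n\setminus\{b\}$ is a global $C^1$-diffeomorphism.
   Context: Here $\det Df=\det(\partial f_i/\partial x_j)$ is the Jacobian of $f=(f_1,\dots,f_n)$. A global homeomorphism is a homeomorphism of the whole domain onto the whole target. A global $C^1$-diffeomorphism between two open sets is a bijective $C^1$ map of the first onto the second whose inverse is also $C^1$. *)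

(* Defs.v *)
From mathcomp Require Import all_boot all_order all_algebra.
From mathcomp Require Import all_classical all_reals all_analysis.

Set Implicit Arguments.
Unset Strict Implicit.
Unset Printing Implicit Defensive.

Import Order.TTheory GRing.Theory Num.Theory.
Import numFieldNormedType.Exports.

Local Open Scope classical_set_scope.
Local Open Scope ring_scope.

(* R^n is 'rV[R]_n. The norm `|x| that the library puts on it is the sup norm;
   it induces the usual topology and the usual notion of differentiability.
   The Euclidean length has to be given separately. *)
Definition enorm (R : realType) (n : nat) (x : 'rV[R]_n) : R :=
  Num.sqrt (\sum_(i < n) x 0 i ^+ 2).

(* Meant for open U. Vectors being rows, the (i, j) entry of [jacobian f x] is
   the partial derivative of f_j with respect to x_i, i.e., it is the transpose
   of the usual Df(x); its determinant is the same. *)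
Definition C1_on (R : realType) (n m : nat) (U : set 'rV[R]_n)
    (f : 'rV[R]_n -> 'rV[R]_m) : Prop :=
  forall x, U x -> differentiable f x /\ {for x, continuous (jacobian f)}.

Definition homeomorphism (S T : topologicalType) (f : S -> T) : Prop :=
  continuous f /\
  exists g : T -> S, [/\ cancel f g, cancel g f & continuous g].

(* f and its inverse g are total functions, of which only the values on U,
   resp. V, matter. *)
Definition C1_diffeomorphism (R : realType) (n : nat) (U V : set 'rV[R]_n)
    (f : 'rV[R]_n -> 'rV[R]_n) : Prop :=
  [/\ open U, open V, set_bij U V f, C1_on U f
    & exists g : 'rV[R]_n -> 'rV[R]_n, {in U, cancel f g} /\ C1_on V g].

(* Main.v *)
(* Off a, f is a local homeomorphism (inverse function theorem), and it is proper as
   a map from R^n \ {a} to R^n \ {b}. Hence segments of R^n \ {b} lift, together with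
   a convex tube around them, which yields a continuous section of f on the set of
   points visible from f(x), i.e., on the complement of a half-line issued from b.
   A second section, on an open half-space containing that half-line, can be chosen
   to agree with the first one at a point, hence on the half-space minus the
   half-line, which is connected as n >= 3. This gives a section of f on the whole of
   R^n \ {b} through any given x, and so f is injective: a section through x is a
   left inverse of f along every path of R^n \ {a} starting at x. The inverse is
   continuous at b by properness, and C^1 elsewhere since its Jacobian matrix is the
   inverse of the one of f. *)
Require Import Defs.
From mathcomp Require Import all_boot all_order all_algebra.
From mathcomp Require Import all_classical all_reals all_analysis.
From mathcomp Require Import ring lra.

Set Implicit Arguments.
Unset Strict Implicit.
Unset Printing Implicit Defensive.

Import Order.TTheory GRing.Theory Num.Theory.
Import numFieldNormedType.Exports.

Local Open Scope classical_set_scope.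
Local Open Scope ring_scope.

(** * Lifting through a proper local homeomorphism *)

(** Connectedness of [0, 1]: [P] and its negation are both relatively open there. *)
Lemma segment_ind (R : realType) (P : R -> Prop) :
  P 0 ->
  (forall t, 0 <= t <= 1 -> P t -> \forall s \near t, 0 <= s <= 1 -> P s) ->
  (forall t, 0 <= t <= 1 -> ~ P t -> \forall s \near t, 0 <= s <= 1 -> ~ P s) ->
  forall t, 0 <= t <= 1 -> P t.
Proof.
move=> P0 Popen Pclosed t t01.
have itvE s : `[0, 1]%classic s = (0 <= s <= 1) by rewrite /= in_itv.
suff /seteqP[_ sub] : `[0, 1]%classic `&` [set s | P s] = `[0, 1]%classic.
  by have [] := sub t _; rewrite // itvE.
apply: (@segment_connected R 0 1).
- by exists 0; split => //; rewrite itvE lexx ler01.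
- exists ([set s | 0 <= s <= 1 -> P s]°); first exact: open_interior.
  apply/seteqP; split => s [s01 Ps]; split => //.
    by apply: Popen Ps; rewrite -itvE.
  by apply: (interior_subset Ps); rewrite -itvE.
- exists (~` [set s | 0 <= s <= 1 -> ~ P s]°).
    exact/open_closedC/open_interior.
  apply/seteqP; split => s [s01 Ps]; split => //.
    by move/interior_subset; apply => //; rewrite -itvE.
  by apply: contrapT => nPs; apply: Ps; apply: Pclosed => //; rewrite -itvE.
Qed.

Definition seg (R : realType) (V : normedModType R) (x y : V) (t : R) : V :=
  x + t *: (y - x).

Section Segments.
Context (R : realType) (V : normedModType R).
Implicit Types x y z : V.

Lemma seg0 x y : seg x y 0 = x.
Proof. by rewrite /seg scale0r addr0. Qed.

Lemma seg1 x y : seg x y 1 = y.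
Proof. by rewrite /seg scale1r addrC subrK. Qed.

Lemma continuous_seg x y : continuous (seg x y).
Proof.
move=> t; apply: cvgD; first exact: cvg_cst.
by apply: cvgZr_tmp; exact: cvg_id.
Qed.

Definition segment_convex (C : set V) :=
  forall x y t, C x -> C y -> 0 <= t <= 1 -> C (seg x y t).

End Segments.

Section Lifts.
Context (R : realType) (V W : normedModType R) (f : V -> W).

Definition locally_injective_at (x : V) :=
  exists2 U, nbhs x U & forall y z, U y -> U z -> f y = f z -> y = z.

(** The parameters of the segment at which the two lifts agree form a set that is open by local
    injectivity and closed by continuity of the difference. It serves for two sections of [f], and
    later for [s \o f] against the identity. *)
Lemma lift_unique (g1 g2 : W -> V) (C : set W) (p q : W) :
  segment_convex C -> C p -> C q ->
  (forall z, C z -> {for z, continuous g1}) ->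
  (forall z, C z -> {for z, continuous g2}) ->
  (forall z, C z -> locally_injective_at (g1 z)) ->
  (forall z, C z -> f (g1 z) = f (g2 z)) ->
  g1 p = g2 p -> g1 q = g2 q.
Proof.
move=> Cconv Cp Cq c1 c2 finj fg gp.
suff: forall t, 0 <= t <= 1 -> g1 (seg p q t) = g2 (seg p q t).
  by move=> /(_ 1); rewrite seg1; apply; rewrite ler01 lexx.
have gcont (g : W -> V) (t : R) : (forall z, C z -> {for z, continuous g}) ->
    0 <= t <= 1 -> g (seg p q s) @[s --> t] --> g (seg p q t).
  move=> cg t01; apply: (@continuous_comp _ _ _ (seg p q) g).
    exact: continuous_seg.
  by apply: cg; exact: Cconv.
apply: segment_ind; first by rewrite !seg0.
- move=> t t01 eqt.
  have Ct : C (seg p q t) by exact: Cconv.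
  have [U nU injU] := finj _ Ct.
  have n1 := gcont _ _ c1 t01 _ nU.
  rewrite eqt in nU.
  have n2 := gcont _ _ c2 t01 _ nU.
  near=> s => s01; apply: injU; [by near: s | by near: s|].
  by apply: fg; exact: Cconv.
- move=> t t01 /eqP neqt.
  have : g1 (seg p q s) - g2 (seg p q s) @[s --> t] -->
      g1 (seg p q t) - g2 (seg p q t) by apply: cvgB; exact: gcont.
  rewrite -subr_eq0 in neqt.
  move/cvgr_neq0 => /(_ neqt) h; near=> s => _; apply/eqP.
  by rewrite -subr_eq0; near: s.
Unshelve. all: by end_near. Qed.
End Lifts.

(** * Convex tubes around segments *)

Section Tubes.
Context (R : realType) (n : nat).
Notation V := 'rV[R]_n.
Implicit Types (v y z : V) (t d : R).

Definition tube v y t d : set V :=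
  \bigcup_(u in `[0, t]%classic) ball (seg v y u) d.

Lemma ballE v d z : ball v d z = (`|v - z| < d).
Proof. by rewrite -ball_normE. Qed.

Lemma tubeP v y t d z :
  tube v y t d z <-> exists2 u, 0 <= u <= t & `|seg v y u - z| < d.
Proof.
split=> -[u ut zu]; exists u.
- by move: ut; rewrite /= in_itv.
- by rewrite -ballE.
- by rewrite /= in_itv.
- by rewrite ballE.
Qed.

Lemma open_tube v y t d : open (tube v y t d).
Proof. by apply: bigcup_open => u _; exact: ball_open. Qed.

Lemma segment_convex_tube v y t d : segment_convex (tube v y t d).
Proof.
move=> z1 z2 l /tubeP[u1 /andP[u10 u1t] h1] /tubeP[u2 /andP[u20 u2t] h2].
(* With the same convex combination of the two parameters, the error vector is that combination of
   the two errors. *)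
move=> /andP[l0 l1]; apply/tubeP; exists (seg (u1 : R^o) u2 l).
  by rewrite /seg /GRing.scale/=; apply/andP; split; nra.
have -> : seg v y (seg (u1 : R^o) u2 l) - seg z1 z2 l =
    (1 - l) *: (seg v y u1 - z1) + l *: (seg v y u2 - z2).
  by apply/rowP => i; rewrite /seg /GRing.scale/= !mxE; ring.
set A := seg v y u1 - z1 in h1 *; set B := seg v y u2 - z2 in h2 *.
have hm : Num.max `|A| `|B| < d by rewrite gt_max h1.
have hA : `|A| <= Num.max `|A| `|B| by rewrite le_max lexx.
have hB : `|B| <= Num.max `|A| `|B| by rewrite le_max lexx orbT.
apply: le_lt_trans hm; rewrite (le_trans (ler_normD _ _))//.
rewrite !normrZ (ger0_norm l0) ger0_norm ?subr_ge0//.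
by move: hA hB; set m := Num.max _ _; nra.
Qed.

Lemma segment_convex_ball v d : segment_convex (ball v d).
Proof.
have -> : ball v d = tube v v 0 d.
  apply/seteqP; split=> z.
    by rewrite ballE => vz; apply/tubeP; exists 0; rewrite ?lexx ?seg0.
  move=> /tubeP[u /andP[u0 u0']]; have -> : u = 0 by apply/eqP; rewrite eq_le u0'.
  by rewrite seg0 ballE.
exact: segment_convex_tube.
Qed.

Lemma segment_convexI (A B : set V) :
  segment_convex A -> segment_convex B -> segment_convex (A `&` B).
Proof. by move=> cA cB x y t [Ax Bx] [Ay By] t01; split; [apply: cA|apply: cB]. Qed.

Lemma convex_comb_gt0 (A B t : R) :
  0 < A -> 0 < B -> 0 <= t <= 1 -> 0 < (1 - t) * A + t * B.
Proof.
move=> A0 B0 /andP[t0 t1]; have [->|tn0] := eqVneq t 0; first by lra.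
have : 0 < t * B by rewrite mulr_gt0// lt_neqAle eq_sym tn0.
have : 0 <= (1 - t) * A by rewrite mulr_ge0 ?subr_ge0 // ltW.
by lra.
Qed.

(** The form in which [3 <= n] enters the geometry: a coordinate direction other than two given
    ones, which may coincide. *)
Lemma third_index (i j : 'I_n) : (3 <= n)%N -> exists2 k, k != i & k != j.
Proof.
move=> n3; have : (0 < #|~: [set i; j]|)%N.
  rewrite cardsCs finset.setCK cards2 card_ord subn_gt0.
  by apply: leq_ltn_trans n3; case: (i != j).
by move=> /card_gt0P[k]; rewrite !inE negb_or => /andP[]; exists k.
Qed.

Lemma neq_coord (x y : V) : x != y -> exists i, x 0 i != y 0 i.
Proof.
move=> xy; apply/existsP; apply: contra_neqT xy => /existsPn h.
by apply/rowP => i; apply/eqP; rewrite -[_ == _]negbK.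
Qed.

End Tubes.

(** * Local and global sections *)

Section Sections.
Context (R : realType) (n : nat) (f : 'rV[R]_n -> 'rV[R]_n).
Notation V := 'rV[R]_n.

(** Continuity is that of the total function [s] at the points of [D], not of its restriction to
    [D]; the two agree for open [D]. *)
Definition section_on (s : V -> V) (D : set V) :=
  forall y, D y -> f (s y) = y /\ {for y, continuous s}.

Lemma section_onS s (A B : set V) : A `<=` B -> section_on s B -> section_on s A.
Proof. by move=> AB sB y /AB; exact: sB. Qed.

Lemma section_on_glue s1 s2 (A B : set V) : open A -> open B ->
  section_on s1 A -> section_on s2 B -> (forall y, A y -> B y -> s1 y = s2 y) ->
  exists s, [/\ section_on s (A `|` B), forall y, A y -> s y = s1 y &
    forall y, B y -> s y = s2 y].
Proof.
move=> oA oB h1 h2 h12.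
pose s y := if y \in A then s1 y else s2 y.
have sA y : A y -> s y = s1 y by rewrite /s => Ay; rewrite mem_set.
have sB y : B y -> s y = s2 y.
  by rewrite /s => By; case: ifPn => //; rewrite inE => Ay; exact: h12.
exists s; split => // y.
have aux s' (C : set V) : open C -> (forall z, C z -> s z = s' z) ->
    section_on s' C -> C y -> f (s y) = y /\ {for y, continuous s}.
  move=> oC eqs hs Cy; have [fs cs] := hs _ Cy; split; first by rewrite eqs.
  have : s' z @[z --> y] --> s y by rewrite (eqs _ Cy).
  apply: cvg_trans; apply: (@near_eq_cvg _ _ (nbhs y)).
  by near=> z; rewrite eqs//; near: z; apply: open_nbhs_nbhs.
by case; [exact: (aux s1)|exact: (aux s2)].
Unshelve. all: by end_near. Qed.

Section ProperLocalHomeo.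
Variable a : V.
Hypothesis fcont : continuous f.
Hypothesis finj : forall x, x != a -> locally_injective_at f x.
Hypothesis fsec : forall x, x != a -> exists2 r, 0 < r &
  exists2 s, s (f x) = x & section_on s (ball (f x) r).
Hypothesis fab : forall x, x != a -> f x != f a.
Hypothesis fproper : forall K, compact K -> compact (f @^-1` K).

(* A good section avoids the value [f a], hence takes its values off [a]. *)
Definition good_section (s : V -> V) (D : set V) :=
  section_on s D /\ forall y, D y -> y != f a.

Lemma good_section_neq s D y : good_section s D -> D y -> s y != a.
Proof.
by move=> [hs hD] Dy; apply: contra_neq (hD _ Dy) => <-; have [] := hs _ Dy.
Qed.

(** The intersection of [A] and [B] is convex, and [s1] takes its values off [a], where [f] is
    locally injective. *)
Lemma good_section_unique s1 s2 (A B : set V) p q :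
  segment_convex A -> segment_convex B -> good_section s1 A -> good_section s2 B ->
  A p -> B p -> s1 p = s2 p -> A q -> B q -> s1 q = s2 q.
Proof.
move=> cA cB h1 h2 Ap Bp e Aq Bq.
apply: (@lift_unique _ _ _ f s1 s2 (A `&` B) p q) => //.
- exact: segment_convexI.
- by move=> z [Az Bz]; have [] := h1.1 _ Az.
- by move=> z [Az Bz]; have [] := h2.1 _ Bz.
- by move=> z [Az Bz]; apply/finj/(good_section_neq h1).
- by move=> z [Az Bz]; have [-> _] := h1.1 _ Az; have [-> _] := h2.1 _ Bz.
Qed.

(* By compactness of [f @^-1` K], the radius of the balls carrying local sections
   can be chosen uniformly. *)
Lemma uniform_section (K : set V) : compact K -> ~ K (f a) ->
  exists2 e, 0 < e & forall x, K (f x) ->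
    exists2 s, s (f x) = x & good_section s (ball (f x) e).
Proof.
move=> cK Ka.
have /compact_near_coveringP cov := fproper cK.
pose P (e : R) x := exists2 s, s (f x) = x & good_section s (ball (f x) e).
(* Near-covering form of compactness: a property of [x'] near each [x] and of all small [e > 0]
   holds, for some [e], on the whole compact set. *)
suff step : forall x, (f @^-1` K) x ->
    \forall x' \near x & e \near 0^'+, P e x'.
  have hF := cov R 0^'+ P _ step; near (0 : R)^'+ => e; exists e.
    by near: e; exact: nbhs_right_gt.
  by move=> x Kx; move: x Kx; near: e; exact: hF.
move=> x Kx.
  have xa : x != a by apply: contra_notN Ka => /eqP <-.
  have [r0 r00 [s sx hs]] := fsec xa.
  have [U nU injU] := finj xa.
  (* The second bound keeps the ball around [f x] away from [f a]. *)
  pose r := Num.min r0 `|f x - f a|.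
  have r_gt0 : 0 < r by rewrite lt_min r00 normr_gt0 subr_eq0 fab.
  have cs : (s \o f) z @[z --> x] --> x.
    rewrite -[X in _ --> X]sx; apply: (@continuous_comp _ _ _ f s).
      exact: fcont.
    by have [] := hs (f x) (ballxx _ r00).
  have h1 := cs _ nU.
  have h2 : \forall z \near x, `|f x - f z| < r / 2.
    have /cvgrPdist_lt := @fcont x.
    by apply; rewrite divr_gt0.
  near=> x' e => /=.
  have e0 : 0 < e by near: e; exact: nbhs_right_gt.
  have ball_sub : ball (f x') e `<=` ball (f x) r.
    move=> z; rewrite !ballE => h.
    have h' : `|f x - f x'| < r / 2 by near: x'; exact: h2.
    have he : e < r / 2.
      by near: e; apply: nbhs_right_lt; rewrite divr_gt0.
    rewrite -(subrK (f x') (f x)) -addrA (le_lt_trans (ler_normD _ _))//.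
    by lra.
  have ball_sub0 : ball (f x') e `<=` ball (f x) r0.
    by move=> z /ball_sub; rewrite !ballE /r lt_min => /andP[].
  (* The same [s] serves all [x'] near [x]: [s (f x')] and [x'] lie in [U] and have the same
     image. *)
  exists s.
    apply: injU; [by near: x' | by near: x' |].
    by have [] := hs (f x') (ball_sub0 _ (ballxx _ e0)).
  split.
    exact: section_onS hs.
  move=> y /ball_sub; rewrite ballE lt_min => /andP[_].
  by apply: contraTN => /eqP ->; rewrite ltxx.
Unshelve. all: by end_near. Qed.

(** Continuity method on the length [t] of the lifted part. The radius [e] of [uniform_section] does
    not depend on [t], so a lift up to [t1] yields one up to any [t2] within a fixed distance; this
    gives openness and closedness at once. *)
Lemma tube_section x y : x != a ->
  (forall t, 0 <= t <= 1 -> seg (f x) y t != f a) ->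
  exists2 d, 0 < d & exists2 s, s (f x) = x & good_section s (tube (f x) y 1 d).
Proof.
move=> xa xyb; set v := f x.
pose K := seg v y @` `[0, 1]%classic.
have KP t : 0 <= t <= 1 -> K (seg v y t).
  by move=> t01; exists t => //=; rewrite in_itv.
have cK : compact K.
  apply: continuous_compact; last exact: segment_compact.
  exact/continuous_subspaceT/continuous_seg.
have Ka : ~ K (f a).
  by move=> [t]; rewrite /= in_itv/= => t01 /eqP; apply/negP/xyb.
have [e e0 he] := uniform_section cK Ka.
pose P t := exists2 d, 0 < d & exists2 s, s v = x & good_section s (tube v y t d).
have Pstep t1 t2 : 0 <= t1 <= 1 -> 0 <= t2 -> `|t1 - t2| * `|y - v| < e ->
    P t1 -> P t2.
  move=> /andP[t10 t11] t20 t12e [d d0 [s sv hs]].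
  have [t21|t12] := leP t2 t1.
    exists d => //; exists s => //; split=> [|z /tubeP[u /andP[u0 ut] vu]].
      apply: section_onS hs.1 => z /tubeP[u /andP[u0 ut] vu].
      by apply/tubeP; exists u => //; rewrite u0 (le_trans ut).
    by apply: hs.2; apply/tubeP; exists u => //; rewrite u0 (le_trans ut).
  have tubev : tube v y t1 d v.
    by apply/tubeP; exists 0; rewrite ?lexx // seg0 subrr normr0.
  set p := seg v y t1.
  have tubep : tube v y t1 d p.
    by apply/tubeP; exists t1; rewrite ?lexx ?t10 // subrr normr0.
  have fsp : f (s p) = p by have [] := hs.1 _ tubep.
  (* Beyond [p], the lift is continued by the section through [s p] on the ball of radius [e] around
     [p]. *)
  have [|s' + hs'] := he (s p); first by rewrite fsp; apply: KP; rewrite t10.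
  rewrite fsp in hs' * => s'p.
  have [z tz bz|s'' [hs'' eqs _]] :=
      section_on_glue (@open_tube _ _ v y t1 d) (ball_open p (e : R)) hs.1 hs'.1.
    apply: (good_section_unique _ _ hs hs' tubep (ballxx _ e0)) => //.
      exact: segment_convex_tube.
    exact: segment_convex_ball.
  (* The second bound makes the balls of radius [d'] centred between the parameters [t1] and [t2]
     fit in the ball of radius [e] around [p]. *)
  pose d' := Num.min d (e - (t2 - t1) * `|y - v|).
  have d'0 : 0 < d'.
    by move: t12e; rewrite ltr0_norm ?subr_lt0// opprB lt_min d0 subr_gt0.
  have sub : tube v y t2 d' `<=` tube v y t1 d `|` ball p e.
    move=> z /tubeP[u /andP[u0 ut2]]; rewrite lt_min => /andP[zd ze].
    have [ut1|ut1] := leP u t1.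
      by left; apply/tubeP; exists u; rewrite ?u0.
    right; rewrite ballE -(subrK (seg v y u) p) -addrA.
    rewrite (le_lt_trans (ler_normD _ _))// -ltrBrDl (lt_le_trans ze)//.
    have -> : p - seg v y u = (t1 - u) *: (y - v).
      by apply/rowP => i; rewrite !mxE; ring.
    by rewrite lerB// normrZ ler_wpM2r// ltr0_norm ?subr_lt0// opprB lerB.
  exists d' => //; exists s''; first by rewrite eqs.
  split; first exact: section_onS hs''.
  by move=> z /sub[]; [exact: hs.2|exact: hs'.2].
have near_small (t : R) : \forall s \near t, `|t - s| * `|y - v| < e.
  have h : 0 < e / (`|y - v| + 1) by rewrite divr_gt0// ltr_wpDl.
  near=> s.
  have : `|t - s| < e / (`|y - v| + 1).
    near: s; exact: (@cvgr_dist_lt R R^o R (nbhs t) _ id t cvg_id _ h).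
  rewrite ltr_pdivlMr ?ltr_wpDl//; apply: le_lt_trans.
  by rewrite ler_wpM2l// lerDl.
suff: P 1 by [].
apply: (@segment_ind R P); last by rewrite ler01 lexx.
- exists e => //; have [|s sx hs] := he x.
    by have := KP 0; rewrite seg0 lexx ler01; apply.
  exists s => //.
  have sub : tube v y 0 e `<=` ball v e.
    move=> z /tubeP[u /andP[u0 u0']].
    have -> : u = 0 by apply/eqP; rewrite eq_le u0'.
    by rewrite seg0 ballE.
  by split; [exact: section_onS hs.1|move=> z /sub; exact: hs.2].
- move=> t t01 Pt; near=> s => /andP[s0 _]; apply: Pstep Pt => //.
  by near: s; exact: near_small.
- move=> t /andP[t0 _] nPt; near=> s => s01 Ps; apply: nPt.
  by apply: Pstep Ps => //; rewrite distrC; near: s; exact: near_small.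
Unshelve. all: by end_near. Qed.

(* The complement of a closed half-line issued from [f a]. *)
Definition sees x : set V :=
  [set y | forall t, 0 <= t <= 1 -> seg (f x) y t != f a].

(* The lift [s] is defined pointwise, by lifting segments from [f x]; two lifting
   tubes have a convex intersection containing [f x], so the lifts agree. *)
Lemma good_section_star x : x != a ->
  exists2 s, s (f x) = x & open (sees x) /\ good_section s (sees x).
Proof.
move=> xa; set v := f x.
have tubev y d : 0 < d -> tube v y 1 d v.
  by move=> d0; apply/tubeP; exists 0; rewrite ?lexx ?ler01 // seg0 subrr normr0.
have tubey y d : 0 < d -> tube v y 1 d y.
  by move=> d0; apply/tubeP; exists 1; rewrite ?lexx ?ler01 // seg1 subrr normr0.
have [s hs] : {s : V -> V & forall y, sees x y ->
    exists2 d, 0 < d & exists2 s', s' v = x /\ s' y = s y &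
      good_section s' (tube v y 1 d)}.
  apply: (@choice _ _ (fun y z => sees x y ->
    exists2 d, 0 < d & exists2 s', s' v = x /\ s' y = z &
      good_section s' (tube v y 1 d))) => y.
  have [ys|nys] := pselect (sees x y); last by exists 0.
  have [d d0 [s sv hs]] := tube_section xa ys.
  by exists (s y) => _; exists d => //; exists s.
(* A tube is convex, contains [v], and avoids [f a] when it carries a good section, so all its
   points are visible. *)
have sub y d s' : good_section s' (tube v y 1 d) -> 0 < d -> 
    tube v y 1 d `<=` sees x.
  move=> h d0 z tz t t01; apply: h.2; apply: segment_convex_tube => //.
  exact: tubev.
have near_sees y : sees x y -> \forall z \near y, sees x z.
  move=> ys; have [d d0 [s' _ h]] := hs _ ys.
  apply: filterS (sub _ _ _ h d0) _.
  by apply: open_nbhs_nbhs; split; [exact: open_tube|exact: tubey].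
have sees_v : sees x v.
  by move=> t _; rewrite /seg subrr scaler0 addr0 fab.
exists s.
  have [d d0 [s' [s'v s'y] _]] := hs _ sees_v.
  by rewrite -s'y.
split; first by rewrite openE.
have ssee y : sees x y -> y != f a.
  by move=> /(_ 1); rewrite seg1; apply; rewrite lexx ler01.
split; last exact: ssee.
move=> y ys; have [d d0 [s1 [s1v s1y] h1]] := hs _ ys.
have [fs1 cs1] := h1.1 _ (tubey _ _ d0).
split; first by rewrite -s1y.
have : s1 z @[z --> y] --> s y by rewrite -s1y.
apply: cvg_trans; apply: (@near_eq_cvg _ _ (nbhs y)).
have : \forall z \near y, tube v y 1 d z.
  by apply: open_nbhs_nbhs; split; [exact: open_tube|exact: tubey].
apply: filterS => z tz.
have zs := sub _ _ _ h1 d0 _ tz.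
have [d2 d20 [s2 [s2v s2z] h2]] := hs _ zs.
rewrite -s2z; apply: (good_section_unique _ _ h1 h2 (tubev _ _ d0) (tubev _ _ d20)).
- exact: segment_convex_tube.
- exact: segment_convex_tube.
- by rewrite s1v.
- by [].
- exact: tubey.
Qed.

Lemma good_sectionS s (A B : set V) :
  A `<=` B -> good_section s B -> good_section s A.
Proof. by move=> AB [h1 h2]; split; [exact: section_onS h1|move=> y /AB/h2]. Qed.

Lemma global_section x : (3 <= n)%N -> x != a ->
  exists2 s, s (f x) = x & good_section s (~` [set f a]).
Proof.
move=> n3 xa; set v := f x; set b := f a.
pose e := v - b.
have [i0 ei0] : exists i0, e 0 i0 != 0.
  have [i vi] := neq_coord (fab xa).
  by exists i; rewrite !mxE subr_eq0.
have eE k : v 0 k = b 0 k + e 0 k by rewrite !mxE; ring.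
clearbody e.
have e2 : 0 < e 0 i0 * e 0 i0 by rewrite -expr2 exprn_even_gt0.
(* The half-line not covered by [sees x] lies in the half-space [H]. The rest of
   [H] is covered by the convex sets [G i c], where [c] is a sign; any two of them
   are connected through common points because [3 <= n]. *)
pose L i (y : V) := (y 0 i - b 0 i) * e 0 i0 - (y 0 i0 - b 0 i0) * e 0 i.
pose H : set V := [set y | 0 < - ((y 0 i0 - b 0 i0) * e 0 i0)].
pose G i (c : R) : set V := H `&` [set y | 0 < c * L i y].
have cH : segment_convex H.
  move=> y z t Hy Hz t01; rewrite /H /=.
  by have := convex_comb_gt0 Hy Hz t01; congr (0 < _); rewrite !mxE; ring.
have cG i c : segment_convex (G i c).
  apply: segment_convexI => // y z t Ly Lz t01; rewrite /= /L.
  by have := convex_comb_gt0 Ly Lz t01; congr (0 < _); rewrite /L !mxE; ring.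
have Hb y : H y -> y != b.
  by rewrite /H /=; apply: contraTneq => ->; rewrite subrr mul0r oppr0 ltxx.
(* If the segment from [v] to [y] met [b], then [y - b] and [e] would be linearly dependent, whereas
   [L i y] is one of their 2 by 2 minors. *)
have Gsees i c : G i c `<=` sees x.
  move=> y [_ /= Ly] t t01; apply/eqP => /rowP st.
  have hk k : (1 - t) * e 0 k + t * (y 0 k - b 0 k) = 0.
    by have := st k; rewrite !mxE -/v -/b eE => stk; lra.
  have : t * L i y = 0.
    rewrite /L; have h1 := hk i; have h2 := hk i0.
    have -> : t * ((y 0 i - b 0 i) * e 0 i0 - (y 0 i0 - b 0 i0) * e 0 i) =
      ((1 - t) * e 0 i + t * (y 0 i - b 0 i)) * e 0 i0 -
      ((1 - t) * e 0 i0 + t * (y 0 i0 - b 0 i0)) * e 0 i by ring.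
    by rewrite h1 h2 !mul0r subrr.
  move/eqP; rewrite mulf_eq0 => /orP[/eqP t0|/eqP L0]; last first.
    by move: Ly; rewrite L0 mulr0 ltxx.
  by have := hk i0; rewrite t0; move/eqP: ei0; lra.
(* If all minors vanish, then [y] is [b] plus [c] times [e] with [c < 0], and the segment from
   [v = b + e] reaches [b] at the parameter [(1 - c)^-1]. *)
have Hcover y : H y -> sees x y -> exists i c, i != i0 /\ (c = 1 \/ c = - 1) /\ G i c y.
  move=> Hy ys; apply: contrapT => nex.
  have Li i : L i y = 0.
    have [->|ii0] := eqVneq i i0; first by rewrite /L subrr.
    apply: contrapT => /eqP; rewrite neq_lt => /orP[L0|L0]; apply: nex.
      by exists i, (- 1); do !split => //; [right|rewrite /= mulN1r oppr_gt0].
    by exists i, 1; do !split => //; [left|rewrite /= mul1r].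
  pose c := (y 0 i0 - b 0 i0) / e 0 i0.
  have c0 : c < 0.
    have : 0 < - (c * (e 0 i0 * e 0 i0)) by rewrite /c mulrA divfK.
    by rewrite oppr_gt0 pmulr_llt0.
  have c1 : 1 - c != 0 by apply/eqP; lra.
  have /negP : seg v y (1 - c)^-1 != b.
    by apply: ys; rewrite invr_ge0 invf_le1; lra.
  apply; apply/eqP/rowP => k; rewrite !mxE -/v -/b eE.
  have -> : y 0 k = b 0 k + c * e 0 k.
    rewrite /c; have := Li k; rewrite /L => /eqP; rewrite subr_eq0 => /eqP hL.
    by rewrite mulrAC -hL mulfK// addrC subrK.
  by field.
(* For distinct [i], [j] other than [i0], a common point of [G i 1] and [G j c]: the term [- e] puts
   it in [H], and there [L i] is the square of [e 0 i0] and [L j] is [c] times that. *)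
pose pt i j c : V := b - e + e 0 i0 *: (delta_mx 0 i + c *: delta_mx 0 j).
have ptH i j c : i != i0 -> j != i0 -> H (pt i j c).
  move=> /negPf ii /negPf ji; rewrite /H /= !mxE eq_sym ii eq_sym ji /=.
  by rewrite ?eqxx /=; lra.
have ptG i j c : i != i0 -> j != i0 -> i != j -> (c = 1 \/ c = - 1) ->
    G i 1 (pt i j c) /\ G j c (pt i j c).
  move=> ii ji ij hc; split; (split; first exact: ptH); rewrite /= /L !mxE.
    rewrite !eqxx (eq_sym i0) (negPf ii) (eq_sym i0) (negPf ji) (negPf ij).
    by move: e2 => /=; lra.
  rewrite !eqxx (eq_sym i0) (negPf ii) (eq_sym i0) (negPf ji) eq_sym (negPf ij).
  by move: e2 => /=; case: hc => ->; lra.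
have [i1 i10 _] := third_index i0 i0 n3.
have [i2 i20 i21] := third_index i0 i1 n3.
pose y0 := pt i1 i2 1.
have [Gy1 Gy2] : G i1 1 y0 /\ G i2 1 y0.
  by apply: ptG => //; rewrite ?(eq_sym i1) //; left.
have [s1 s1v [os1 hs1]] := good_section_star xa.
have y0s := Gsees _ _ _ Gy1.
(* Based at [s1 y0], the section [s2] agrees with [s1] at [y0]. As [H] is convex, contains [y0] and
   misses [b], it is visible from [y0]. *)
have [s2 s2v [_ hs2]] := good_section_star (good_section_neq hs1 y0s).
have fs1y0 : f (s1 y0) = y0 by have [] := hs1.1 _ y0s.
have {}hs2 : good_section s2 H.
  apply: good_sectionS hs2 => y Hy t t01; apply: Hb; apply: cH => //.
  by rewrite fs1y0; exact: Gy1.1.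
rewrite fs1y0 in s2v.
have spread i c p : G i c p -> s1 p = s2 p -> forall y, G i c y -> s1 y = s2 y.
  move=> Gp eqp y Gy.
  apply: (good_section_unique (cG i c) (cG i c) _ _ Gp Gp eqp Gy Gy).
    exact: good_sectionS hs1.
  by apply: good_sectionS hs2 => ? [].
have agree1 := spread _ _ _ Gy1 (esym s2v).
have agree2 := spread _ _ _ Gy2 (esym s2v).
(* Agreement spreads from [G i1 1] to any [G i c] through a point [pt]; for [i = i1] it comes from
   [G i2 1], since [G i1 1] and [G i1 (- 1)] are disjoint. *)
have agree y : sees x y -> H y -> s1 y = s2 y.
  move=> ys Hy; have [i [c [ii0 [hc Gi]]]] := Hcover _ Hy ys.
  have [ii1|ii1] := eqVneq i i1.
    have [|h1 h2] := ptG i2 i c i20 ii0 _ hc; first by rewrite ii1.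
    by apply: spread h2 _ _ Gi; exact: agree2.
  have [|h1 h2] := ptG i1 i c i10 ii0 _ hc; first by rewrite eq_sym.
  by apply: spread h2 _ _ Gi; exact: agree1.
have oH : open H.
  rewrite openE => y Hy; rewrite /interior.
  have : - ((z 0 i0 - b 0 i0) * e 0 i0) @[z --> y] -->
      - ((y 0 i0 - b 0 i0) * e 0 i0).
    apply: cvgN; apply: cvgMr_tmp; apply: cvgB; last exact: cvg_cst.
    exact: coord_continuous.
  by move/cvgr_gt; apply.
have [s [hs eqs _]] := section_on_glue os1 oH hs1.1 hs2.1 agree.
exists s.
  rewrite eqs//; move=> t _; rewrite /seg subrr scaler0 addr0; exact: fab.
(* If [y] is not visible, then [y - b] is a negative multiple of [e]. *)
have ssub : ~` [set b] `<=` sees x `|` H.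
  move=> y /= yb; have [ys|/existsNP[t /not_implyP[t01 /negP]]] := pselect (sees x y).
    by left.
  rewrite negbK => /eqP/rowP st; right.
  have hk k : (1 - t) * e 0 k + t * (y 0 k - b 0 k) = 0.
    by have := st k; rewrite !mxE -/v -/b eE => stk; lra.
  have t0 : t != 0.
    by apply/eqP => t0; have := hk i0; rewrite t0; move/eqP: ei0; lra.
  have t1 : t != 1.
    apply/eqP => t1; apply: yb; apply/rowP => k; have := hk k; rewrite t1; lra.
  have {t01 t0 t1} [t0 t1] : 0 < t /\ t < 1.
    by move: t01 => /andP[]; rewrite le_eqVlt eq_sym (negPf t0) le_eqVlt (negPf t1).
  rewrite /H /= -(pmulr_lgt0 _ t0).
  have -> : - ((y 0 i0 - b 0 i0) * e 0 i0) * t = (1 - t) * (e 0 i0 * e 0 i0).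
    have := hk i0; have -> : t * (y 0 i0 - b 0 i0) = (y 0 i0 - b 0 i0) * t by ring.
    by move=> h; have := congr1 (fun z => z * e 0 i0) h; lra.
  by rewrite mulr_gt0// subr_gt0.
split; first exact: section_onS hs.
by move=> y /= /eqP.
Qed.

Lemma proper_local_homeo_injective x0 x1 : (3 <= n)%N -> x0 != a -> x1 != a ->
  f x0 = f x1 -> x0 = x1.
Proof.
move=> n3 x0a x1a fx01.
have [s sx0 hs] := global_section n3 x0a.
have fneq z : z != a -> (~` [set f a]) (f z) by move=> /fab/eqP.
(* Over a segment [C] off [a], both [s \o f] and the identity lift [f], so they agree at [q] if they
   do at [p]. *)
have step p q : (forall t, 0 <= t <= 1 -> seg p q t != a) ->
    s (f p) = p -> s (f q) = q.
  move=> pqa; pose C := seg p q @` `[0, 1]%classic.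
  have Ca z : C z -> z != a by move=> [t]; rewrite /= in_itv/= => t01 <-; exact: pqa.
  apply: (@lift_unique _ _ _ f (s \o f) id C p q).
  - move=> _ _ t [t1 + <-] [t2 + <-] /andP[t0 t_1]; rewrite /= !in_itv/=.
    move=> /andP[t10 t11] /andP[t20 t21]; exists (t1 + t * (t2 - t1)).
      by rewrite /= in_itv/=; apply/andP; split; nra.
    by apply/rowP => i; rewrite !mxE; ring.
  - by exists 0; rewrite ?seg0 //= in_itv/= lexx ler01.
  - by exists 1; rewrite ?seg1 //= in_itv/= lexx ler01.
  - move=> z /Ca za; apply: continuous_comp; first exact: fcont.
    by have [] := hs.1 _ (fneq _ za).
  - by move=> z _; exact: cvg_id.
  - move=> z /Ca za; apply: finj; apply: (good_section_neq hs); exact: fneq.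
  - by move=> z /Ca za; have [] := hs.1 _ (fneq _ za).
have [i0 h0] := neq_coord x0a.
have [i1 h1] := neq_coord x1a.
have [j j0 j1] := third_index i0 i1 n3.
(* Segments to [w] avoid [a]: coordinate [i] equals that of [a] only at [t = 1], where coordinate
   [j] differs by 1. *)
pose w := a + delta_mx 0 j.
have miss (x : V) i : x 0 i != a 0 i -> j != i -> forall t, seg x w t != a.
  move=> xi ji t; apply/eqP => /rowP st.
  have := st i; rewrite !mxE eqxx /= eq_sym (negPf ji) /= addr0 => sti.
  have /eqP : (1 - t) * (x 0 i - a 0 i) = 0 by lra.
  rewrite mulf_eq0 (subr_eq0 (x 0 i)) (negPf xi) orbF => /eqP t1.
  have := st j; rewrite !mxE !eqxx /=.
  have -> : t = 1 by lra.
  by lra.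
have sw : s (f w) = w by apply: step sx0 => t _; exact: miss h0 j0 t.
have sx1 : s (f x1) = x1.
  apply: step sw => t /andP[t0 t1].
  have -> : seg w x1 t = seg x1 w (1 - t) by apply/rowP => i; rewrite !mxE; ring.
  exact: miss h1 j1 _.
by rewrite -sx0 -sx1 fx01.
Qed.

End ProperLocalHomeo.

End Sections.

(** * The inverse function theorem *)

Section MatrixNorm.
Context (R : realType).

Lemma mx_norm_coord m n (A : 'M[R]_(m, n)) i j : `|A i j| <= `|A|.
Proof.
rewrite [leRHS]/Num.Def.normr/= mx_normrE.
exact: (le_bigmax _ (fun ij : 'I_m * 'I_n => `|A ij.1 ij.2|) (i, j)).
Qed.

Lemma mx_norm_le m n (A : 'M[R]_(m, n)) e :
  0 <= e -> (forall i j, `|A i j| <= e) -> `|A| <= e.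
Proof.
by move=> e0 he; rewrite [leLHS]/Num.Def.normr/= mx_normrE bigmax_le.
Qed.

(** The norm is the largest modulus of an entry, not an operator norm, whence the factor [n]. *)
Lemma mx_norm_mulmx m n p (A : 'M[R]_(m, n)) (B : 'M[R]_(n, p)) :
  `|A *m B| <= n%:R * `|A| * `|B|.
Proof.
apply: mx_norm_le => [|i j]; first by rewrite !mulr_ge0.
rewrite mxE (le_trans (ler_norm_sum _ _ _))//.
apply: (@le_trans _ _ (\sum_(k < n) `|A| * `|B|)).
  by apply: ler_sum => k _; rewrite normrM ler_pM// mx_norm_coord.
by rewrite sumr_const card_ord -mulrA mulr_natl.
Qed.

End MatrixNorm.

Section StrictDifferentiability.
Context (R : realType) (n m : nat) (f : 'rV[R]_n -> 'rV[R]_m).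

Lemma is_derive_seg (w z : 'rV[R]_n) (t : R) j :
  differentiable f (seg w z t) ->
  is_derive t 1 (fun s : R => f (seg w z s) 0 j)
    (((z - w) *m jacobian f (seg w z t)) 0 j).
Proof.
move=> df; set p := seg w z t; set v := z - w.
pose g (s : R) := f (seg w z s).
have E : (fun h : R => h^-1 *: ((g \o shift t) (h *: 1) - g t)) =
    (fun h : R => h^-1 *: ((f \o shift p) (h *: v) - f p)).
  apply/funext => h; congr (_ *: (f _ - _)).
  by rewrite /seg/= /p /seg /GRing.scale/=; apply/rowP => i; rewrite !mxE; ring.
have gdf : derivable g t 1 by rewrite /derivable E; exact: diff_derivable.
have gD : 'D_1 g t = v *m jacobian f p.
  by rewrite /derive E -[LHS]/('D_v f p) deriveEjacobian.
apply: DeriveDef; first exact: (derivable_mxP g t 1).1.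
by rewrite -gD derive_mx// mxE.
Qed.

(** Mean value theorem on the segment from [w] to [z], for each coordinate of [f] minus its linear
    part; under the sup norm each coordinate may have its own intermediate point. *)
Lemma strict_differentiability x0 : (\forall x \near x0, differentiable f x) ->
  {for x0, continuous (jacobian f)} ->
  forall e, 0 < e -> exists2 d, 0 < d &
    (forall z, ball x0 d z -> differentiable f z) /\
    forall z w, ball x0 d z -> ball x0 d w ->
      `|f z - f w - (z - w) *m jacobian f x0| <= e * `|z - w|.
Proof.
move=> df cJ e e0.
(* Dividing by [n + 1] absorbs the factor [n] of [mx_norm_mulmx]. *)
have e'0 : 0 < e / (n%:R + 1) by rewrite divr_gt0// ltr_wpDl.
have hJ : \forall x \near x0, `|jacobian f x0 - jacobian f x| < e / (n%:R + 1).
  by move/cvgrPdist_lt : cJ; apply.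
have /nbhs_ballP[d /= d0 hd] : \forall x \near x0, differentiable f x /\
    `|jacobian f x0 - jacobian f x| < e / (n%:R + 1) by apply: filterI df hJ.
exists d => //; split=> [z /hd[]//|z w xz xw].
apply: mx_norm_le => [|i j]; first by rewrite mulr_ge0// ltW.
rewrite ord1; set v := z - w.
pose c := (v *m jacobian f x0) 0 j.
pose phi (s : R) := f (seg w z s) 0 j - s * c.
have segb (t : R) : 0 <= t <= 1 -> ball x0 d (seg w z t).
  by move=> t01; exact: segment_convex_ball.
have dphi (t : R) : 0 <= t <= 1 ->
    is_derive t 1 phi ((v *m jacobian f (seg w z t)) 0 j - c).
  move=> t01; have [dft _] := hd _ (segb _ t01).
  have h1 := is_derive_seg j dft.
  have h2 : is_derive t 1 (fun s : R => s * c) c.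
    by apply: is_derive_eq; rewrite /GRing.scale/=; ring.
  have -> : phi = (fun s : R => f (seg w z s) 0 j) - (fun s : R => s * c) by [].
  exact: (is_deriveB h1 h2).
have [||t] := @MVT_segment R phi (fun t => (v *m jacobian f (seg w z t)) 0 j - c)
  0 1 ler01.
- move=> t; rewrite in_itv/= => /andP[t0 t1]; apply: dphi.
  by rewrite !ltW.
- apply: derivable_within_continuous => t; rewrite in_itv/= => t01.
  by have := dphi _ t01; case.
rewrite in_itv/= => t01; rewrite subr0 mulr1 {1 2}/phi seg0 seg1 mul0r mul1r subr0.
have -> : (f z - f w - v *m jacobian f x0) 0 j = f z 0 j - c - f w 0 j.
  by rewrite /c !mxE; ring.
move=> ->.
have -> : (v *m jacobian f (seg w z t)) 0 j - c =
    (v *m (jacobian f (seg w z t) - jacobian f x0)) 0 j.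
  by rewrite mulmxBr [RHS]mxE [X in _ = _ + X]mxE.
rewrite (le_trans (mx_norm_coord _ _ _))// (le_trans (mx_norm_mulmx _ _))//.
have [_ /ltW hJt] := hd _ (segb _ t01).
rewrite distrC in hJt.
rewrite mulrAC ler_wpM2r//; apply: (@le_trans _ _ (n%:R * (e / (n%:R + 1)))).
  by rewrite ler_wpM2l.
by rewrite mulrCA ler_piMr ?(ltW e0)// ler_pdivrMr ?mul1r ?lerDl// ltr_wpDl.
Qed.

End StrictDifferentiability.

Lemma near_dist_le (R : realType) m n (x : 'M[R]_(m, n)) (e : R) :
  0 < e -> \forall y \near x, `|x - y| <= e.
Proof.
by move=> e0; apply: (@cvgr_dist_le _ _ _ (nbhs x) _ id x) => //; exact: cvg_id.
Qed.

Lemma mulmxr_continuous (R : realType) n m p (A : 'M[R]_(m, p)) :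
  continuous (fun u : 'M[R]_(n, m) => u *m A).
Proof.
move=> u; apply/(@cvgrPdist_le _ _ _ (nbhs u)) => e e0; near=> w.
have C0 : 0 < m%:R * `|A| + 1 by rewrite ltr_wpDl// mulr_ge0.
rewrite -mulmxBl (le_trans (mx_norm_mulmx _ _))// mulrAC.
apply: (@le_trans _ _ ((m%:R * `|A| + 1) * `|u - w|)).
  by rewrite ler_wpM2r// lerDl.
rewrite -ler_pdivlMl//.
near: w; apply: near_dist_le.
by rewrite mulr_gt0// invr_gt0.
Unshelve. all: by end_near. Qed.

(** * Local inverses and their regularity *)

Section LocalInverse.
Context (R : realType) (n : nat) (f : 'rV[R]_n -> 'rV[R]_n).
Notation V := 'rV[R]_n.

(** With [A] the inverse of the Jacobian matrix at [x0], the map [f z *m A] is the identity plus a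
    1/2-Lipschitz map near [x0]. This gives injectivity and a Lipschitz inverse; surjectivity comes
    from minimizing a distance. *)
Lemma local_inverse x0 : (\forall x \near x0, differentiable f x) ->
  {for x0, continuous (jacobian f)} -> \det (jacobian f x0) != 0 ->
  locally_injective_at f x0 /\ exists2 r, 0 < r &
    exists2 s, s (f x0) = x0 & section_on f s (ball (f x0) r).
Proof.
move=> df cJ detJ; set J := jacobian f x0.
have Ju : J \in unitmx by rewrite unitmxE unitfE.
pose A := invmx J.
pose C := n%:R * `|A| + 1.
have C0 : 0 < C by rewrite ltr_wpDl// mulr_ge0.
have AC (u : V) : `|u *m A| <= C * `|u|.
  rewrite (le_trans (mx_norm_mulmx _ _))// mulrAC ler_wpM2r//.
  by rewrite lerDl.
have [|d d0 [dfd hd]] := strict_differentiability df cJ (e := (2 * C)^-1).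
  by rewrite invr_gt0 mulr_gt0.
have gd z w : ball x0 d z -> ball x0 d w ->
    `|f z *m A - f w *m A - (z - w)| <= 2^-1 * `|z - w|.
  move=> xz xw; have -> : f z *m A - f w *m A - (z - w) =
      (f z - f w - (z - w) *m J) *m A.
    by rewrite !mulmxBl -!mulmxA mulmxV// !mulmx1.
  rewrite (le_trans (AC _))//; apply: le_trans (ler_wpM2l (ltW C0) (hd _ _ xz xw)) _.
  by rewrite invfM mulrA mulrCA divff ?gt_eqF// mulr1.
have ginj z w : ball x0 d z -> ball x0 d w ->
    `|z - w| <= 2 * `|f z *m A - f w *m A|.
  move=> xz xw; have := gd _ _ xz xw.
  have := ler_normB (f z *m A - f w *m A) (f z *m A - f w *m A - (z - w)).
  by rewrite opprB addrC subrK; lra.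
have finj z w : ball x0 d z -> ball x0 d w -> `|z - w| <= 2 * C * `|f z - f w|.
  move=> xz xw; rewrite (le_trans (ginj _ _ xz xw))// -mulrA ler_wpM2l//.
  by rewrite -mulmxBl AC.
have injf z w : ball x0 d z -> ball x0 d w -> f z = f w -> z = w.
  move=> xz xw fzw; apply/eqP; rewrite -subr_eq0 -normr_le0.
  by rewrite (le_trans (finj _ _ xz xw))// fzw subrr normr0 mulr0.
split; first by exists (ball x0 d) => //; exact: nbhsx_ballx.
pose r := d / (16 * C).
have r0 : 0 < r by rewrite divr_gt0// mulr_gt0.
have Cr : C * r = d / 16 by rewrite /r; field; rewrite gt_eqF.
exists r => //.
(* [f z *m A] is at distance at most [|f z *m A - y *m A| / 2] from [y *m A] after
   one Newton step from [z], so a minimizer of that distance is a solution. *)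
have surj y : ball (f x0) r y -> exists2 z, ball x0 d z & f z = y.
  rewrite ballE => yr; pose K : set V := closed_ball_ Num.Def.normr x0 (d / 2).
  have Kd z : K z -> ball x0 d z.
    by rewrite /K/closed_ball_/= ballE => h; apply: le_lt_trans h _; lra.
  have cK : compact K.
    apply: bounded_closed_compact; last exact: closed_closed_ball_.
    exists (`|x0| + d / 2); split; first exact: num_real.
    move=> M hM z Kz; apply: le_trans (ltW hM).
    rewrite -(subrK x0 z) (le_trans (ler_normD _ _))// [leLHS]addrC lerD2l distrC.
    exact: Kz.
  have K0 : K x0 by rewrite /K/closed_ball_/= subrr normr0 divr_ge0// ltW.
  have cphi : {within K, continuous (fun z => `|f z *m A - y *m A| : R)}.
    apply: continuous_in_subspaceT => z; rewrite inE => /Kd /dfd dfz.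
    apply: (@continuous_comp _ _ _ f (fun u => `|u *m A - y *m A|)).
      exact: differentiable_continuous.
    apply: (@continuous_comp _ _ _ (fun u : V => u *m A - y *m A) Num.Def.normr).
      have cA : u *m A @[u --> f z] --> f z *m A.
        exact: mulmxr_continuous.
      exact: (cvgB cA (cvg_cst _)).
    exact: norm_continuous.
  have [z + hz] := EVT_min_rV (ex_intro _ _ K0) cK cphi.
  rewrite inE => Kz; exists z; first exact: Kd.
  have x0z : `|f z *m A - y *m A| <= C * r.
    apply: le_trans (hz x0 _) _; first by rewrite inE.
    by rewrite -mulmxBl (le_trans (AC _))// ler_wpM2l ?ltW.
  pose w := z - (f z *m A - y *m A).
  (* The minimizer is within [d / 4] of [x0] and the correction is at most [C * r = d / 16], so [w]
     stays in the ball of radius [d / 2]. *)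
  have Kw : K w.
    have h1 := ginj _ _ (Kd _ Kz) (ballxx x0 d0).
    have h2 : `|f z *m A - f x0 *m A| <= C * r + C * r.
      rewrite -(subrK (y *m A) (f z *m A)) -addrA (le_trans (ler_normD _ _))//.
      rewrite lerD// -mulmxBl (le_trans (AC _))// ler_wpM2l ?ltW//.
      by rewrite distrC.
    rewrite /K/closed_ball_/=.
    have -> : x0 - w = (f z *m A - y *m A) - (z - x0).
      by rewrite /w; apply/rowP => i; rewrite !mxE; ring.
    rewrite (le_trans (ler_normB _ _))//; move: x0z h2; rewrite Cr; lra.
  have hw := hz w; rewrite inE in hw; have {hw} := hw Kw.
  have hwz : `|f w *m A - y *m A| <= 2^-1 * `|f z *m A - y *m A|.
    have := gd w z (Kd _ Kw) (Kd _ Kz).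
    have -> : w - z = - (f z *m A - y *m A).
      by rewrite /w; apply/rowP => i; rewrite !mxE; ring.
    rewrite normrN; apply: le_trans; rewrite opprK.
    rewrite le_eqVlt; apply/orP; left; apply/eqP; congr (`| _ |).
    by apply/rowP => i; rewrite !mxE; ring.
  have := normr_ge0 (f z *m A - y *m A) => h1 h2.
  have /eqP : `|f z *m A - y *m A| = 0 by lra.
  rewrite normr_eq0 -mulmxBl => /eqP h0.
  have : (f z - y) *m A *m J = 0 by rewrite h0 mul0mx.
  by rewrite -mulmxA mulVmx// mulmx1 => /eqP; rewrite subr_eq0 => /eqP.
have [s hs] : {s : V -> V & forall y, ball (f x0) r y ->
    ball x0 d (s y) /\ f (s y) = y}.
  apply: (@choice _ _ (fun y z => ball (f x0) r y -> ball x0 d z /\ f z = y)).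
  move=> y; have [yr|nyr] := pselect (ball (f x0) r y); last by exists 0.
  by have [z xz fz] := surj _ yr; exists z.
exists s.
  have [h1 h2] := hs _ (ballxx _ r0).
  exact: injf (ballxx _ d0) h2.
move=> y yr; have [sy fsy] := hs _ yr; split => //.
apply/(@cvgrPdist_le _ _ _ (nbhs y)) => e e0; near=> z.
have zr : ball (f x0) r z.
  by near: z; apply: open_nbhs_nbhs; split => //; exact: ball_open.
have [sz fsz] := hs _ zr.
rewrite (le_trans (finj _ _ sy sz))// fsy fsz -ler_pdivlMl ?mulr_gt0//.
near: z; apply: near_dist_le.
by rewrite mulr_gt0// invr_gt0 mulr_gt0.
Unshelve. all: by end_near. Qed.

(** Put h = g(y + k) - g(y), which tends to 0 with k. Differentiability of [f] reads k = hJ + o(h),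
    so h = kA + o(h) with A the inverse of J; hence h = O(k), and the error is o(k). *)
Lemma differentiable_inverse (g : V -> V) y : {for y, continuous g} ->
  (\forall y' \near y, f (g y') = y') -> differentiable f (g y) ->
  \det (jacobian f (g y)) != 0 ->
  differentiable g y /\ jacobian g y = invmx (jacobian f (g y)).
Proof.
move=> cg fg df detJ; set x := g y; set J := jacobian f x.
have Ju : J \in unitmx by rewrite unitmxE unitfE.
pose A := invmx J.
pose C := n%:R * `|A| + 1.
have C0 : 0 < C by rewrite ltr_wpDl// mulr_ge0.
have AC (u : V) : `|u *m A| <= C * `|u|.
  rewrite (le_trans (mx_norm_mulmx _ _))// mulrAC ler_wpM2r//.
  by rewrite lerDl.
pose L : {linear V -> V} := mulmxr A.
have cL : continuous L by exact: mulmxr_continuous.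
have fgy : f x = y by exact: nbhs_singleton fg.
have cshift : k + y @[k --> (0 : V)] --> y.
  have := @cvgD _ _ _ (nbhs (0 : V)) _ id (cst y) 0 y cvg_id (cvg_cst y).
  by rewrite add0r; apply.
have lim0 : g (k + y) - x @[k --> (0 : V)] --> (0 : V).
  have := cvgB (cvg_comp _ _ cshift cg) (cvg_cst x).
  by rewrite subrr; apply.
have key : g \o shift y = cst (g y) + L +o_ (0 : V) id.
  apply/eqaddoP => e e0.
  have [_ /eqaddoP] := (diff_locallyP x f).1 df.
  (* The first bound lets half of the norm of h be absorbed, so that h is at most 2C times k in
     norm; the second then brings the error down to [e] times k. *)
  pose e1 := Num.min ((2 * C)^-1) (e / (2 * C * C)).
  have e10 : 0 < e1.
    by rewrite lt_min invr_gt0 divr_gt0// !mulr_gt0.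
  move=> /(_ _ e10) hf.
  have {hf} := lim0 _ hf.
  rewrite /= => hf; have hfg := cshift _ fg; near=> k.
  have fk : f (g (k + y)) = k + y by near: k; exact: hfg.
  have : `|(f \o shift x - (cst (f x) + 'd f x)) (g (k + y) - x)| <= e1 * `|g (k + y) - x|.
    by near: k.
  rewrite /= !fctE /= subrK fk fgy.
  have -> : 'd f x (g (k + y) - x) = (g (k + y) - x) *m J.
    by rewrite /J /jacobian mul_rV_lin1.
  set h := g (k + y) - x => hk.
  have -> : g (k + y) - (g y + k *m A) = - ((k + y - (y + h *m J)) *m A).
    have -> : k + y - (y + h *m J) = k - h *m J.
      by rewrite opprD addrA addrK.
    by rewrite mulmxBl -mulmxA mulmxV// mulmx1 opprB /h opprD addrA.
  rewrite normrN; set u := _ - _ in hk *.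
  have hC : `|u *m A| <= C * e1 * `|h|.
    by rewrite (le_trans (AC _))// -mulrA ler_wpM2l ?(ltW C0).
  have hkA : `|k *m A| <= C * `|k| by exact: AC.
  have e1C : C * e1 <= 2^-1.
    apply: (@le_trans _ _ (C * (2 * C)^-1)).
      by rewrite ler_wpM2l ?(ltW C0)// ge_min lexx.
    by rewrite invfM mulrCA divff ?gt_eqF// mulr1.
  have hE : h = k *m A - u *m A.
    rewrite -mulmxBl /u; have -> : k - (k + y - (y + h *m J)) = h *m J.
      by apply/rowP => i; rewrite !mxE; ring.
    by rewrite -mulmxA mulmxV// mulmx1.
  have hh : `|h| <= 2 * C * `|k|.
    have h1 := ler_normB (k *m A) (u *m A); rewrite -hE in h1.
    have h2 := ler_wpM2r (normr_ge0 h) e1C; lra.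
  apply: le_trans hC _; apply: (@le_trans _ _ (C * e1 * (2 * C * `|k|))).
    by rewrite ler_wpM2l// mulr_ge0// ltW.
  rewrite mulrA ler_wpM2r//.
  apply: (@le_trans _ _ (C * (e / (2 * C * C)) * (2 * C))).
    by rewrite ler_wpM2r ?mulr_ge0 ?(ltW C0)// ler_wpM2l ?(ltW C0)// ge_min lexx orbT.
  by rewrite le_eqVlt; apply/orP; left; apply/eqP; field; rewrite gt_eqF.
have dgL : 'd g y = L :> (V -> V) by exact: diff_unique.
split.
  apply/diff_locallyP; rewrite dgL; split => //.
apply/row_matrixP => i; rewrite !rowE mul_rV_lin1.
by rewrite dgL.
Unshelve. all: by end_near. Qed.

(** For the inverses A and B of J(y) and J(z), one has B - A = B(J(y) - J(z))A. For z close to y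
    this bounds B by twice A in norm, and then B - A. *)
Lemma continuous_invmx_comp (J : V -> 'M[R]_n) y : (\forall z \near y, J z \in unitmx) ->
  {for y, continuous J} -> {for y, continuous (fun z => invmx (J z))}.
Proof.
move=> Ju cJ; have Juy : J y \in unitmx by exact: nbhs_singleton Ju.
set A := invmx (J y); pose N : R := n%:R.
have N0 : 0 <= N by [].
apply/(@cvgrPdist_le _ _ _ (nbhs y)) => e e0.
pose K := N * N * `|A| + 1.
have K0 : 0 < K by rewrite ltr_wpDl// !mulr_ge0.
pose d := Num.min ((2 * K)^-1) (e / (2 * K * (`|A| + 1))).
have A1 : 0 < `|A| + 1 by rewrite ltr_wpDl.
have d0 : 0 < d by rewrite lt_min invr_gt0 divr_gt0// !mulr_gt0.
have hJ : \forall z \near y, `|J y - J z| <= d by move/cvgrPdist_le : cJ; apply.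
near=> z.
have Jz : J z \in unitmx by near: z.
have Jd : `|J y - J z| <= d by near: z.
set B := invmx (J z).
have BA : B - A = B *m (J y - J z) *m A.
  by rewrite mulmxBr mulVmx// mulmxBl mul1mx -mulmxA mulmxV// mulmx1.
have h1 : `|A - B| <= `|B| * (K * `|J y - J z|).
  rewrite distrC BA (le_trans (mx_norm_mulmx _ _))//.
  apply: (@le_trans _ _ (N * (N * `|B| * `|J y - J z|) * `|A|)).
    by rewrite ler_wpM2r// ler_wpM2l// mx_norm_mulmx.
  rewrite /K; have -> : N * (N * `|B| * `|J y - J z|) * `|A| =
    `|B| * (N * N * `|A| * `|J y - J z|) by ring.
  by rewrite ler_wpM2l// ler_wpM2r// lerDl.
have h2 : K * `|J y - J z| <= 2^-1.
  apply: le_trans (ler_wpM2l (ltW K0) Jd) _.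
  apply: (@le_trans _ _ (K * (2 * K)^-1)).
    by rewrite ler_wpM2l ?(ltW K0)// ge_min lexx.
  by rewrite invfM mulrCA divff ?gt_eqF// mulr1.
have h3 : K * `|J y - J z| <= e / (2 * (`|A| + 1)).
  apply: le_trans (ler_wpM2l (ltW K0) Jd) _.
  apply: (@le_trans _ _ (K * (e / (2 * K * (`|A| + 1))))).
    by rewrite ler_wpM2l ?(ltW K0)// ge_min lexx orbT.
  rewrite le_eqVlt; apply/orP; left; apply/eqP; field.
  by rewrite !gt_eqF.
have B2 : `|B| <= 2 * `|A|.
  have := ler_normB A (A - B); rewrite opprB addrC subrK => h4.
  have := ler_wpM2l (normr_ge0 B) h2; lra.
apply: le_trans h1 _.
apply: (@le_trans _ _ (2 * `|A| * (e / (2 * (`|A| + 1))))).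
  by rewrite ler_pM// mulr_ge0 ?(ltW K0).
have -> : 2 * `|A| * (e / (2 * (`|A| + 1))) = e * (`|A| / (`|A| + 1)).
  by field; rewrite gt_eqF.
by rewrite ler_piMr ?(ltW e0)// ler_pdivrMr// mul1r lerDl.
Unshelve. all: by end_near. Qed.

End LocalInverse.

(** * Properness and conclusion *)

Section Euclidean.
Context (R : realType) (n : nat).
Notation V := 'rV[R]_n.

Lemma norm_le_enorm (x : V) : `|x| <= enorm x.
Proof.
apply: mx_norm_le => [|i j]; first exact: sqrtr_ge0.
rewrite ord1 /enorm -sqrtr_sqr ler_sqrt ?sumr_ge0// => [|k _]; last exact: sqr_ge0.
rewrite (bigD1 j)//= lerDl sumr_ge0// => k _; exact: sqr_ge0.
Qed.

Lemma enorm_le_norm (x : V) : enorm x <= Num.sqrt n%:R * `|x|.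
Proof.
rewrite -[X in _ * X]normr_id -sqrtr_sqr -sqrtrM//.
rewrite ler_sqrt ?mulr_ge0 ?sqr_ge0//.
apply: (@le_trans _ _ (\sum_(i < n) `|x| ^+ 2)).
  apply: ler_sum => i _; rewrite -[leLHS]real_normK ?num_real//.
  by rewrite lerXn2r ?nnegrE// mx_norm_coord.
by rewrite sumr_const card_ord mulr_natl.
Qed.

(** The preimage is closed and bounded. Growth is measured by the Euclidean length, boundedness by
    the sup norm, whence the two comparisons. *)
Lemma compact_preimage (f : V -> V) : continuous f ->
  (forall M : R, exists K : R, forall y, K < enorm y -> M < enorm (f y)) ->
  forall K : set V, compact K -> compact (f @^-1` K).
Proof.
move=> cf fproper K cK; apply: bounded_closed_compact; last first.
  apply: preimage_closed; first by move=> x _; exact: cf.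
  exact: (compact_closed (@norm_hausdorff _ _) cK).
have [M [_ hM]] := compact_bounded cK.
have KM z : K z -> enorm z <= Num.sqrt n%:R * (M + 1).
  move=> Kz; apply: le_trans (enorm_le_norm z) _.
  by rewrite ler_wpM2l ?sqrtr_ge0//; apply: hM Kz; rewrite ltrDl.
have [B hB] := fproper (Num.sqrt n%:R * (M + 1)).
exists B; split; first exact: num_real.
move=> B' BB' z /= Kz; apply: le_trans (norm_le_enorm z) _.
apply: le_trans (ltW BB'); rewrite leNgt; apply/negP => /hB.
by apply/negP; rewrite -leNgt KM.
Qed.

End Euclidean.

Theorem theorem2p3 (R : realType) (n : nat) (hn : (3 <= n)%N)
    (a : 'rV[R]_n) (f : 'rV[R]_n -> 'rV[R]_n)
    (fC1 : C1_on (~` [set a]) f)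
    (fdet : forall x, x != a -> \det (jacobian f x) != 0)
    (fcont : {for a, continuous f})
    (b : 'rV[R]_n) (hb : b = f a)
    (fab : f @` (~` [set a]) `<=` ~` [set b])
    (fproper : forall M : R, exists K : R,
       forall y : 'rV[R]_n, K < enorm y -> M < enorm (f y)) :
  homeomorphism f /\ C1_diffeomorphism (~` [set a]) (~` [set b]) f.
Proof.
have oX (c : 'rV[R]_n) : open (~` [set c]).
  apply: closed_openC; apply: (compact_closed (@norm_hausdorff _ _)).
  exact: compact_set1.
have near_neq (x c : 'rV[R]_n) : x != c -> \forall z \near x, z != c.
  move=> xc; have : \forall z \near x, (~` [set c]) z.
    by apply: open_nbhs_nbhs; split; [exact: oX|exact/eqP].
  by apply: filterS => z /eqP.
have Xdiff x : x != a -> differentiable f x by move=> /eqP /fC1[].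
have XJ x : x != a -> {for x, continuous (jacobian f)} by move=> /eqP /fC1[].
have cf : continuous f.
  move=> x; have [->//|xa] := eqVneq x a.
  exact/differentiable_continuous/Xdiff.
have fneq x : x != a -> f x != f a.
  by move=> /eqP xa; apply/eqP; rewrite -hb; apply: fab; exists x.
have floc x : x != a -> locally_injective_at f x /\ exists2 r, 0 < r &
    exists2 s, s (f x) = x & section_on f s (ball (f x) r).
  move=> xa; apply: local_inverse; [|exact: XJ|exact: fdet].
  by apply: filterS (near_neq _ _ xa) => z; exact: Xdiff.
have finj x (xa : x != a) := (floc x xa).1.
have fsec x (xa : x != a) := (floc x xa).2.
have fcpt := compact_preimage cf fproper.
have [x0 x0a] : exists x0 : 'rV[R]_n, x0 != a.
  exists (a + const_mx 1); apply/eqP => /rowP /(_ (Ordinal (ltnW (ltnW hn)))).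
  by rewrite !mxE; lra.
have [s sx0 hs] := global_section cf finj fsec fneq fcpt hn x0a.
rewrite -hb in fneq hs.
(* As [a] is the only preimage of [b], the inverse has to take the value [a] there. *)
pose g y := if y == b then a else s y.
have gb : g b = a by rewrite /g eqxx.
have gs y : y != b -> g y = s y by rewrite /g => /negPf ->.
have ga y : y != b -> g y != a.
  by move=> yb; rewrite gs//; apply: (good_section_neq hs); exact/eqP.
have fg y : f (g y) = y.
  have [->|yb] := eqVneq y b; first by rewrite gb.
  by rewrite gs//; have [] := hs.1 y (elimN eqP yb).
have gf x : g (f x) = x.
  have [->|xa] := eqVneq x a; first by rewrite -hb.
  apply: (proper_local_homeo_injective cf finj fsec _ fcpt hn) => //.
  - by rewrite -hb.
  - exact/ga/fneq.
have cgs y : y != b -> {for y, continuous g}.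
  move=> yb; have [_] := hs.1 y (elimN eqP yb).
  rewrite /prop_for /continuous_at gs//.
  apply: cvg_trans; apply: (@near_eq_cvg _ _ (nbhs y)).
  by apply: filterS (near_neq _ _ yb) => z /gs ->.
have cgb : {for b, continuous g}.
  apply/(@cvgrPdist_lt _ _ _ (nbhs b)) => e e0; rewrite gb.
  (* Points over the closed unit ball around [b] that are not [e]-close to [a]. The image of this
     compact set is closed and misses [b], so [g y] is outside [D] for [y] near [b]. *)
  pose D := f @^-1` (closed_ball_ Num.Def.normr b 1) `&` ~` ball a e.
  have cB : compact (closed_ball_ Num.Def.normr b 1 : set 'rV[R]_n).
    apply: bounded_closed_compact; last exact: closed_closed_ball_.
    exists (`|b| + 1); split; first exact: num_real.
    move=> M hM z; rewrite /closed_ball_ /= => bz; apply: le_trans (ltW hM).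
    by rewrite -(subrK b z) (le_trans (ler_normD _ _))// [leLHS]addrC lerD2l distrC.
  have cD : compact D.
    apply: compact_closedI; first exact: fcpt.
    exact/open_closedC/ball_open.
  have cfD : closed (f @` D).
    apply: (compact_closed (@norm_hausdorff _ _)).
    by apply: continuous_compact cD; exact: continuous_subspaceT.
  have bD : (~` (f @` D)) b.
    move=> [x [_ Dx] fxb]; apply: Dx.
    have -> : x = a by rewrite -(gf x) fxb gb.
    exact: ballxx.
  near=> y; rewrite -ballE; apply: contrapT => nay.
  have : (~` (f @` D)) y.
    by near: y; apply: open_nbhs_nbhs; split => //; exact: closed_openC.
  apply; exists (g y); last exact: fg.
  split; last exact: nay.
  rewrite /closed_ball_ /= fg; near: y; exact: near_dist_le.
have cg : continuous g by move=> y; have [->|/cgs] := eqVneq y b.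
have dg y : y != b ->
    differentiable g y /\ jacobian g y = invmx (jacobian f (g y)).
  move=> yb; apply: differentiable_inverse; [exact: cg|exact: (filterE _ fg)| |].
    exact/Xdiff/ga.
  exact/fdet/ga.
split; first by split => //; exists g; split.
split; [exact: oX|exact: oX| |exact: fC1|exists g; split].
- split.
  + by move=> x /eqP/fneq/eqP.
  + by move=> x y _ _ fxy; rewrite -(gf x) fxy gf.
  + by move=> y /eqP yb; exists (g y); [exact/eqP/ga|exact: fg].
- by move=> x _; exact: gf.
move=> y /eqP yb; have [dgy Jg] := dg _ yb; split => //.
(* Near [y] this matrix is the Jacobian matrix of [g], so its limit is enough. *)
have : invmx (jacobian f (g z)) @[z --> y] --> jacobian g y.
  rewrite Jg; apply: (@continuous_invmx_comp _ _ (jacobian f \o g) y).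
    apply: filterS (near_neq _ _ yb) => z zb.
    by rewrite unitmxE unitfE; exact/fdet/ga.
  by apply: continuous_comp; [exact: cg|exact/XJ/ga].
apply: cvg_trans; apply: (@near_eq_cvg _ _ (nbhs y)).
by apply: filterS (near_neq _ _ yb) => z zb; exact: esym (dg z zb).2.
Unshelve. all: by end_near. Qed.
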